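(* Let $n$ be a positive integer. For any collection $\{i_1,\ldots,i_k\}\subseteq\{1,\ldots,n\}$ of distinct indices, $k\le n$, one has $$\sigma_{[i_1]}\circ\cdots\circ\sigma_{[i_k]}=\sigma_{[i_1]}\vee\cdots\vee\sigma_{[i_k]},$$ and hence $\sigma_{[i_1,\ldots,i_k]}=\sigma_{[i_1]}\circ\cdots\circ\sigma_{[i_k]}$ is a congruence on $\mathscr{IO}_{\infty}(\mathbb{Z}^n_{\mathrm{lex}})$.
   Context: $L_n=\{1,\ldots,n\}$ with its usual order; $L_n\times_{\mathrm{lex}}\mathbb{Z}$ is $L_n\times\mathbb{Z}$ with the lexicographic order: $(i,m)\leqslant(j,l)$ iff $i<j$, or $i=j$ and $m\le l$. $\mathscr{IO}_{\infty}(\mathbb{Z}^n_{\mathrm{lex}})$ is the inverse monoid of all injective partial maps $\alpha$ from $L_n\times\mathbb{Z}$ to itself that are monotone ($x\leqslant y$ in $\operatorname{dom}\alpha$ implies $(x)\alpha\leqslant(y)\alpha$) and such that both $\operatorname{dom}\alpha$ and $\operatorname{ran}\alpha$ have finite complement in $L_n\times\mathbb{Z}$; the operation is composition of partial maps written on the right, $(x)(\alpha\beta)=((x)\alpha)\beta$. $\mathscr{IO}_{\infty}(\mathbb{Z})$ is the analogous monoid of injective monotone partial selfmaps of $\mathbb{Z}$ (usual order) with cofinite domain and image. Every element of $\mathscr{IO}_{\infty}(\mathbb{Z}^n_{\mathrm{lex}})$ preserves the first coordinate, so $\mathscr{IO}_{\infty}(\mathbb{Z}^n_{\mathrm{lex}})$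 is identified with the direct power $(\mathscr{IO}_{\infty}(\mathbb{Z}))^n$ by $\alpha\leftrightarrow(\alpha_1,\ldots,\alpha_n)$, where $(i,k)\alpha=(i,(k)\alpha_i)$. For $\varepsilon\in\mathscr{IO}_{\infty}(\mathbb{Z})$ let $\varepsilon_i^\circ$ denote the element whose $i$-th coordinate is $\varepsilon$ and whose other coordinates are the identity. The congruence $\sigma_{[i]}$ is defined by: $\alpha\,\sigma_{[i]}\,\beta$ iff there exists an idempotent $\varepsilon\in\mathscr{IO}_{\infty}(\mathbb{Z})$ such that $\alpha\varepsilon_i^\circ=\beta\varepsilon_i^\circ$. Here $\circ$ is composition of binary relations ($\alpha(\rho\circ\tau)\beta$ iff $\alpha\rho\gamma$ and $\gamma\tau\beta$ for some $\gamma$), and $\vee$ is the join in the lattice of congruences. *)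

(* Defs.v *)
From HB Require Import structures.
From mathcomp Require Import all_boot all_order all_algebra.
From mathcomp Require Import all_classical.

Set Implicit Arguments.
Unset Strict Implicit.
Unset Printing Implicit Defensive.

Import Order.TTheory.

Local Open Scope classical_set_scope.

(* A partial selfmap of T is f : T -> option T, with f x = None when x is not
   in the domain. *)
Section PartialMaps.
Context {d : Order.disp_t} {T : porderType d}.
Implicit Types f g : T -> option T.

Definition pdom f : set T := [set x | exists y, f x = Some y].
Definition pran f : set T := [set y | exists x, f x = Some y].

Definition pinjective f :=
  forall x1 x2 y, f x1 = Some y -> f x2 = Some y -> x1 = x2.

Definition pmonotone f :=
  forall x1 x2 y1 y2, f x1 = Some y1 -> f x2 = Some y2 ->
    (x1 <= x2)%O -> (y1 <= y2)%O.

Definition is_io f :=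
  [/\ pinjective f, pmonotone f, cofinite_set (pdom f) & cofinite_set (pran f)].

(* Maps act on the right: (x)(fg) = ((x)f)g. *)
Definition pmul f g : T -> option T := fun x => obind g (f x).

Lemma is_io_id : is_io Some.
Proof.
split.
- by move=> x1 x2 y [->] [->].
- by move=> x1 x2 y1 y2 [->] [->].
- by apply: (sub_cofinite_set _ (cofinite_setT T)) => x _; exists x.
- by apply: (sub_cofinite_set _ (cofinite_setT T)) => x _; exists x.
Qed.

Lemma is_io_mul f g : is_io f -> is_io g -> is_io (pmul f g).
Proof.
move=> [fi fm fd fr] [gi gm gd gr]; split.
- move=> x1 x2 y; rewrite /pmul.
  case f1: (f x1) => [y1|//]; case f2: (f x2) => [y2|//] /= g1 g2.
  by apply: fi f1 _; rewrite (gi _ _ _ g1 g2).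
- move=> x1 x2 y1 y2; rewrite /pmul.
  case f1: (f x1) => [z1|//]; case f2: (f x2) => [z2|//] /= g1 g2 x12.
  exact: gm g1 g2 (fm _ _ _ _ f1 f2 x12).
- pose B : set T := f @^-1` (Some @` ~` pdom g).
  have finB : finite_set B.
    apply: finite_preimage; last exact: finite_image.
    move=> x1 x2; rewrite !inE => -[y1 _ f1] [y2 _ f2] f12.
    by apply: fi (esym f1) _; rewrite -f12.
  apply: (@sub_finite_set _ _ (~` pdom f `|` B)); last by rewrite finite_setU.
  move=> x nx; case: (pselect (pdom f x)) => [[y fxy]|]; last by left.
  right; exists y => // -[z gyz]; apply: nx.
  by exists z; rewrite /pmul fxy.
- pose B : set T := Some @^-1` (g @` ~` pran f).
  have finB : finite_set B.
    by apply: finite_preimage; [move=> x1 x2 _ _ [] | exact: finite_image].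
  apply: (@sub_finite_set _ _ (~` pran g `|` B)); last by rewrite finite_setU.
  move=> z nz; case: (pselect (pran g z)) => [[y gyz]|]; last by left.
  right; exists y => // -[x fxy]; apply: nz.
  by exists x; rewrite /pmul fxy.
Qed.

End PartialMaps.

Record io {d : Order.disp_t} (T : porderType d) := IO {
  io_fun :> T -> option T;
  _ : `[< is_io io_fun >]
}.

HB.instance Definition _ d (T : porderType d) := [isSub for @io_fun d T].
HB.instance Definition _ d (T : porderType d) := [Choice of io T by <:].

Section IoMonoid.
Context {d : Order.disp_t} {T : porderType d}.
Implicit Types a b c : io T.

Lemma ioP a : is_io a.
Proof. by case: a => f /= /asboolP. Qed.

Lemma io_eq a b : a =1 b -> a = b.
Proof. by move=> ab; apply/val_inj/funext. Qed.

Definition mkio (f : T -> option T) (fP : is_io f) : io T := IO (asboolT fP).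

Definition io_one : io T := mkio is_io_id.
Definition io_mul a b : io T := mkio (is_io_mul (ioP a) (ioP b)).

Lemma io_mulA : associative io_mul.
Proof. by move=> a b c; apply: io_eq => x /=; rewrite /pmul; case: (a x). Qed.

Lemma io_mul1 : left_id io_one io_mul.
Proof. by move=> a; apply: io_eq. Qed.

Lemma io_mulr1 : right_id io_one io_mul.
Proof. by move=> a; apply: io_eq => x /=; rewrite /pmul; case: (a x). Qed.

End IoMonoid.

HB.instance Definition _ d (T : porderType d) :=
  isMonoid.Build (io T) (@io_mulA d T) (@io_mul1 d T) (@io_mulr1 d T).

Notation IOZ := (io int).
(* L_n is represented by 'I_n, that is, {0, ..., n - 1}; the notation *l is
   the lexicographic product. *)
Notation IOZlex n := (io ('I_n *l int)%type).

Section DirectPower.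
Variable n : nat.

Definition pow_fun (a : 'I_n -> IOZ) :
    ('I_n *l int)%type -> option ('I_n *l int)%type :=
  fun x => omap (fun m => (x.1, m)) (a x.1 x.2).

Lemma pow_fun_io (a : 'I_n -> IOZ) : is_io (pow_fun a).
Proof.
have fin (P : 'I_n -> set int) (A : set ('I_n *l int)%type) :
    (forall i, finite_set (P i)) -> (forall x, A x -> P x.1 x.2) ->
    finite_set A.
  move=> fP AP; apply: (@sub_finite_set _ _
    (\bigcup_(i in [set: 'I_n]) (pair i @` P i))).
    by move=> x /AP Px; exists x.1 => //; exists x.2 => //; case: x {Px}.
  by apply: bigcup_finite => // i _; apply: finite_image.
split.
- move=> [i1 m1] [i2 m2] [j m]; rewrite /pow_fun /=.
  case e1: (a i1 m1) => [l1|//] [<- <-].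
  case e2: (a i2 m2) => [l2|//] [ei el].
  rewrite ei el in e2 *; have [ai _ _ _] := ioP (a i1).
  by rewrite (ai _ _ _ e1 e2).
- move=> [i1 m1] [i2 m2] [j1 k1] [j2 k2]; rewrite /pow_fun /=.
  case e1: (a i1 m1) => [l1|//] [<- <-].
  case e2: (a i2 m2) => [l2|//] [<- <-].
  rewrite !Order.ProdLexiOrder.leEprodlexi /= => /andP[le12 /implyP m12].
  rewrite le12; apply/implyP => le21.
  have ei : i1 = i2 by apply/le_anti; rewrite le12 le21.
  rewrite -ei in e2; have [_ am _ _] := ioP (a i1).
  exact: am e1 e2 (m12 le21).
- apply: (fin (fun i => ~` pdom (a i))) => [i|[i m] nx [l al]].
    by have [] := ioP (a i).
  by apply: nx; exists (i, l); rewrite /pow_fun /= al.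
- apply: (fin (fun i => ~` pran (a i))) => [i|[i l] nx [m al]].
    by have [] := ioP (a i).
  by apply: nx; exists (i, m); rewrite /pow_fun /= al.
Qed.

(* The element (a_1, ..., a_n) of the direct power: (i, m) |-> (i, (m)a_i). *)
Definition io_pow (a : 'I_n -> IOZ) : IOZlex n := mkio (pow_fun_io a).

Local Open Scope group_scope.

(* The element written e_i with a superscript circle. *)
Definition io_at (i : 'I_n) (e : IOZ) : IOZlex n :=
  io_pow (fun j => if j == i then e else 1).

Definition sigma (i : 'I_n) : set (IOZlex n * IOZlex n) :=
  [set ab | exists2 e : IOZ, e * e = e & ab.1 * io_at i e = ab.2 * io_at i e].

End DirectPower.

Section Congruences.
Variable S : monoidType.
Implicit Types rho tau : set (S * S).

(* The composition \; takes its arguments in the opposite order: x (rho o tau) y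
   holds when x rho z and z tau y for some z. *)
Definition rel_comp rho tau : set (S * S) := (tau \; rho)%relation.

Record congruence rho : Prop := Congruence {
  cong_refl : forall x, rho (x, x);
  cong_sym : forall x y, rho (x, y) -> rho (y, x);
  cong_trans : forall x y z, rho (x, y) -> rho (y, z) -> rho (x, z);
  cong_mul2l : forall z x y, rho (x, y) -> rho (z * x, z * y)%g;
  cong_mul2r : forall z x y, rho (x, y) -> rho (x * z, y * z)%g
}.

(* Join, in the lattice of congruences, of a family of relations. *)
Definition cong_join (I : Type) (rho : I -> set (S * S)) : set (S * S) :=
  smallest congruence (\bigcup_i rho i).

Lemma cong_join_congruence (I : Type) (rho : I -> set (S * S)) :
  congruence (cong_join rho).
Proof.
split=> [x|x y h|x y z h1 h2|z x y h|z x y h] R [cR sR].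
- exact: cong_refl.
- exact: (cong_sym cR (h R (conj cR sR))).
- exact: (cong_trans cR (h1 R (conj cR sR)) (h2 R (conj cR sR))).
- exact: (cong_mul2l cR _ (h R (conj cR sR))).
- exact: (cong_mul2r cR _ (h R (conj cR sR))).
Qed.

End Congruences.

(* The empty composition is the identity relation, which also closes the
   right-nested iterated composition on the right. *)
Definition sigma_comp (n k : nat) (i : 'I_k -> 'I_n) :
    set (IOZlex n * IOZlex n) :=
  \big[@rel_comp (IOZlex n)/diagonal]_(j < k) sigma (i j).

(* Main.v *)
(* Every element preserves the rows {i} x Z: a finite interval of the
   lexicographic order lies in one row.  Hence a sigma_[I] b, meaning that a and
   b coincide after deleting finitely many points of the rows in I from their
   images, is a congruence, and splicing a row of b into a shows that adding an
   index i to I amounts to composing sigma_[i] with sigma_[I]. *)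
Require Import Defs.
From mathcomp Require Import all_boot all_order all_algebra.
From mathcomp Require Import all_classical.
From mathcomp Require Import zify.

Set Implicit Arguments.
Unset Strict Implicit.
Unset Printing Implicit Defensive.

Import Order.TTheory.

Local Open Scope classical_set_scope.

(** * Rows of the lexicographic product and their preservation *)

Section Lexicographic.
Variable n : nat.
Local Notation X := ('I_n *l int)%type.
Implicit Types x y z : X.

Lemma lexi_le_row x y : (x <= y)%O -> (x.1 <= y.1)%O.
Proof. by rewrite Order.ProdLexiOrder.leEprodlexi => /andP[]. Qed.

Lemma lexi_lt_row x y : (x.1 < y.1)%O -> (x < y)%O.
Proof.
move=> xy; rewrite ltNge; apply/negP => /lexi_le_row.
by rewrite leNgt xy.
Qed.

Lemma lexi_le_snd (i : 'I_n) (m l : int) :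
  (((i, m) : X) <= (i, l))%O = (m <= l)%O.
Proof. by rewrite Order.ProdLexiOrder.leEprodlexi /= lexx. Qed.

Lemma infinite_row_above (i : 'I_n) (m : int) :
  infinite_set [set y : X | y.1 = i /\ (m <= y.2)%O].
Proof.
move=> fin; apply: infinite_nat.
pose f k : X := (i, (m + k%:Z)%R).
apply: (@sub_finite_set _ _ (f @^-1` [set y : X | y.1 = i /\ (m <= y.2)%O])).
  by move=> k _; rewrite /f /=; split=> //; lia.
by apply: finite_preimage fin => k l _ _ []; lia.
Qed.

(** Both endpoints squeeze the row of any point between them, which leaves a copy of an integer
    interval. *)
Lemma finite_interval_row x y : x.1 = y.1 ->
  finite_set [set z : X | (x <= z)%O /\ (z <= y)%O].
Proof.
case: x y => [i m] [_ l] /= <-.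
(* The successor makes the offset $l-m$ itself admissible; if $l<m$ the interval is empty and any
   bound does. *)
apply: (@sub_finite_set _ _
  ((fun k : nat => (i, (m + k%:Z)%R) : X) @` `I_(`|(l - m)%R|%N.+1))).
  move=> [j k] [ijk jki].
  have ji : j = i.
    by apply/le_anti; rewrite (lexi_le_row ijk) (lexi_le_row jki).
  move: ijk jki; rewrite ji !lexi_le_snd => mk kl.
  by exists `|(k - m)%R|%N => /=; [lia | congr pair; lia].
exact/finite_image/finite_II.
Qed.

Lemma cofinite_meets_row (A : set X) (i : 'I_n) :
  cofinite_set A -> exists2 y, A y & y.1 = i.
Proof.
move=> cA; apply: contrapT => nA; apply: (@infinite_row_above i 0%R).
by apply: sub_finite_set cA => y [yi _] Ay; apply: nA; exists y.
Qed.

(* Stated for relations in order to apply it to a partial map and its inverse. *)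
Lemma order_iso_row_le (R : X -> X -> Prop) :
    (forall x y y', R x y -> R x y' -> y = y') ->
    (forall x x' y y', R x y -> R x' y' -> (x <= x')%O = (y <= y')%O) ->
    cofinite_set [set y | exists x, R x y] ->
  forall x y, R x y -> (y.1 <= x.1)%O.
Proof.
move=> Rfun Rle Rran.
(* If [x] and [x'] shared a row, the interval between them would be finite. Yet all points above [y]
   in its row lie below [y'], so those in the range, all but finitely many, come from that
   interval. *)
have row_lt x x' y y' : R x y -> R x' y' -> (y.1 < y'.1)%O -> (x.1 < x'.1)%O.
  move=> xy xy' yy'.
  have xx' : (x <= x')%O by rewrite (Rle _ _ _ _ xy xy') ltW // lexi_lt_row.
  rewrite lt_neqAle (lexi_le_row xx') andbT; apply/eqP => ex.
  apply: (@infinite_row_above y.1 y.2).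
  apply: (@sub_finite_set _ _ (~` [set z | exists w, R w z] `|`
    \bigcup_(w in [set w | (x <= w)%O /\ (w <= x')%O]) [set z | R w z])).
    move=> z [zy yz]; have [[w wz]|] := pselect (exists w, R w z); last by left.
    right; exists w => //=; rewrite (Rle _ _ _ _ xy wz) (Rle _ _ _ _ wz xy').
    split; last by rewrite ltW // lexi_lt_row // zy.
    by case: y z zy yz {xy yy' wz} => [i m] [_ l] /= ->; rewrite lexi_le_snd.
  rewrite finite_setU; split => //.
  apply: bigcup_finite => [|w _]; first exact: finite_interval_row.
  have [[z wz]|nw] := pselect (exists z, R w z).
    by apply: sub_finite_set (finite_set1 z) => z' /(Rfun _ _ _ wz) <-.
  by apply: sub_finite_set (@finite_set0 _) => z wz; apply: nw; exists z.
(* Induction on [m]: below [y] there is a value in row [m]; its source lies in row at least [m], and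
   [row_lt] puts [x] in a strictly later row. *)
suff le_row m x y : R x y -> (m <= y.1)%N -> (m <= x.1)%N.
  by move=> x y xy; exact: le_row xy (leqnn _).
elim: m x y => // m IH x y xy my.
have mn : (m < n)%N by exact: ltn_trans my (ltn_ord _).
have [y' [x' xy'] y'm] := cofinite_meets_row (Ordinal mn) Rran.
have := row_lt _ _ _ _ xy' xy; rewrite y'm => /(_ my).
by apply: leq_ltn_trans; apply: IH xy' _; rewrite y'm.
Qed.

(** The order is total, so a failure of reflection would reverse two points, and monotonicity would
    then merge their images against injectivity. *)
Lemma io_le_iff (a : io X) x x' y y' :
  a x = Some y -> a x' = Some y' -> (x <= x')%O = (y <= y')%O.
Proof.
have [ai am _ _] := ioP a => xy xy'.
apply/idP/idP; first exact: am xy xy'.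
move=> yy'; have [//|x'x] := leP x x'.
have ey : y = y' by apply/le_anti; rewrite yy' (am _ _ _ _ xy' xy (ltW x'x)).
by move: x'x; rewrite (ai x x' y) ?ltxx // ey.
Qed.

(** The graph of [a] gives one inequality between rows; the converse graph, whose range is the
    domain of [a], gives the other. *)
Lemma io_row (a : io X) x y : a x = Some y -> y.1 = x.1.
Proof.
have [ai _ ad ar] := ioP a => xy; apply/le_anti/andP; split.
- apply: (@order_iso_row_le (fun x y => a x = Some y)) xy => //.
  + by move=> u v v' -> [].
  + by move=> u u' v v'; exact: io_le_iff.
- apply: (@order_iso_row_le (fun y x => a x = Some y)) xy => //.
  + by move=> u v v' uv uv'; exact: ai uv uv'.
  + by move=> u u' v v' uv uv'; rewrite (io_le_iff uv uv').
Qed.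

End Lexicographic.

(** * Idempotents as partial identities *)

Section RestrictedImage.
Variables (d : Order.disp_t) (T : porderType d).

Lemma io_idem_fix (e : io T) x y : (e * e)%g = e -> e x = Some y -> x = y.
Proof.
have [ei _ _ _] := ioP e => ee exy; apply: (ei _ _ y) => //.
by have := congr1 (fun f : io T => f x) ee; rewrite /= /pmul exy.
Qed.

Definition prestr (F : set T) : T -> option T :=
  fun x => if `[< F x >] then None else Some x.

Lemma prestr_some (F : set T) x y : prestr F x = Some y <-> ~ F x /\ x = y.
Proof.
rewrite /prestr; case: asboolP => Fx; split=> // -[] //.
by move=> _ ->.
Qed.

Lemma is_io_prestr (F : set T) : finite_set F -> is_io (prestr F).
Proof.
move=> fF; split.
- by move=> x1 x2 y /prestr_some[_ ->] /prestr_some[_ ->].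
- by move=> x1 x2 y1 y2 /prestr_some[_ <-] /prestr_some[_ <-].
- apply: sub_finite_set fF => x nx; apply: contrapT => Fx; apply: nx.
  by exists x; apply/prestr_some.
- apply: sub_finite_set fF => x nx; apply: contrapT => Fx; apply: nx.
  by exists x; apply/prestr_some.
Qed.

(** Right multiplication by [prestr F] erases exactly the pairs of a graph whose image lies in
    [F]. *)
Lemma pmul_prestr_eq (F : set T) (f g : T -> option T) :
  pmul f (prestr F) = pmul g (prestr F) <->
  forall x y, ~ F y -> f x = Some y <-> g x = Some y.
Proof.
have pmul_some h x y : pmul h (prestr F) x = Some y <-> h x = Some y /\ ~ F y.
  rewrite /pmul; case: (h x) => [z|] /=; last by split=> // -[].
  rewrite prestr_some; split=> [[Fz <-]|[[->]]] //.
split=> [fg x y Fy|fg].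
  have := pmul_some f x y; rewrite fg pmul_some.
  by move=> [h1 h2]; split=> h; [case: h2 | case: h1].
apply/funext => x; case E: (pmul g _ x) => [y|].
  by move/pmul_some: E => [gx Fy]; apply/pmul_some; rewrite (fg _ _ Fy).
case E': (pmul f _ x) => [y|//].
move/pmul_some: E' => [/[swap] Fy /(fg _ _ Fy) gx].
by rewrite -E; apply/esym/pmul_some.
Qed.

End RestrictedImage.

(** * Congruences attached to sets of rows *)

Section RowCongruences.
Variable n : nat.
Local Notation X := ('I_n *l int)%type.
Implicit Types (I : set 'I_n) (i : 'I_n) (a b c : IOZlex n).

Definition sigma_rows I : set (IOZlex n * IOZlex n) :=
  [set ab : IOZlex n * IOZlex n | exists F : set X,
    [/\ finite_set F, forall y, F y -> I y.1 &
      forall x y, ~ F y -> ab.1 x = Some y <-> ab.2 x = Some y]].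

Lemma io_at_prestr i (e : IOZ) (F : set int) :
  io_fun e = prestr F -> io_fun (io_at i e) = prestr (pair i @` F : set X).
Proof.
move=> eF; apply/funext => -[j m]; rewrite /= /pow_fun /=.
rewrite /prestr; case: eqVneq => [->|ji].
  rewrite eF /prestr; suff -> : (pair i @` F) (i, m) = F m by case: asboolP.
  by apply/propext; split=> [[l Fl [<-]]|Fm] //; exists m.
by case: asboolP => // -[l _ [ij _]]; rewrite ij eqxx in ji.
Qed.

Lemma sigma_rows1 i : sigma i = sigma_rows [set i].
Proof.
apply/seteqP; split=> -[a b] /=.
  move=> [e ee /(congr1 (@io_fun _ _)) /= ab].
  (* An idempotent fixes its domain pointwise, so [e] is the partial identity off this finite
     set. *)
  pose F := ~` pdom e.
  have eF : io_fun e = prestr F.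
    apply/funext => m; rewrite /prestr; case: asboolP => [Fm|].
      by case E: (e m) => [l|//]; case: Fm; exists l.
    by move=> /contrapT[l em]; rewrite em (io_idem_fix ee em).
  exists (pair i @` F); split.
  - by have [_ _ fF _] := ioP e; exact: finite_image.
  - by move=> _ [m _ <-].
  - by apply/pmul_prestr_eq; rewrite -(io_at_prestr i eF).
(* Conversely [F] lies in row [i], hence is a copy of [G], and the partial identity off [G] is the
   required idempotent. *)
move=> [F [fF Fi ab]]; pose G : set int := [set m | F (i, m)].
have fG : finite_set G.
  by apply: finite_preimage fF => m l _ _ [].
have FG : F = pair i @` G.
  apply/seteqP; split=> [[j m] Fjm|_ [m Gm <-] //].
  by have /= ji := Fi _ Fjm; exists m; rewrite /G /= -ji.
exists (mkio (is_io_prestr fG)).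
  by apply: io_eq => m /=; rewrite /pmul /prestr; case: asboolP => //= Gm;
    case: asboolP.
apply: val_inj; rewrite /= [pow_fun _](@io_at_prestr i _ G) //.
by apply/pmul_prestr_eq; rewrite -FG.
Qed.

Lemma sigma_rows_congruence I : congruence (sigma_rows I).
Proof.
split.
- by move=> a; exists set0; split.
- move=> a b [F [fF FI ab]]; exists F; split=> // x y /(ab x y) /= h.
  exact: iff_sym.
- move=> a b c [F [fF FI ab]] [G [fG GI bc]]; exists (F `|` G); split.
  + by rewrite finite_setU.
  + by move=> y [/FI|/GI].
  + move=> x y /not_orP[Fy Gy] /=.
    exact: iff_trans (ab x y Fy) (bc x y Gy).
- move=> c a b [F [fF FI ab]]; exists F; split=> // x y Fy /=.
  by rewrite /pmul; case: (c x) => //= z; exact: ab.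
- move=> c a b [F [fF FI ab]].
  have [ci _ _ _] := ioP c.
  (* The exceptional points move to their images under [c], which stay in the same rows by
     [io_row]. *)
  exists (\bigcup_(y in F) [set z | c y = Some z]); split.
  + apply: bigcup_finite => // y _; case: (c y) => [z|].
      by apply: sub_finite_set (finite_set1 z) => w [->].
    exact: sub_finite_set (@finite_set0 _).
  + by move=> z [y Fy /io_row ->]; exact: FI.
  + have half a' b' :
        (forall x y, ~ F y -> a' x = Some y -> b' x = Some y) ->
        forall x z, ~ (\bigcup_(y in F) [set z | c y = Some z]) z ->
        pmul a' c x = Some z -> pmul b' c x = Some z.
      move=> ab' x z Fz; rewrite /pmul; case E: (a' x) => [y|//] /= cy.
      by rewrite (ab' _ y) // => Fy; apply: Fz; exists y.
    by move=> x z Fz; split; apply: half Fz => u v Fv /(ab u v Fv).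
Qed.

(** * Splicing rows and composing the congruences *)

Definition splice_fun i a b : X -> option X :=
  fun x => if x.1 == i then b x else a x.

(** Since rows are preserved, injectivity reduces to a single row, where only one of [a] and [b]
    acts; points of different rows keep their order automatically. *)
Lemma is_io_splice i a b : is_io (splice_fun i a b).
Proof.
have [ai am ad ar] := ioP a; have [bi bm bd br] := ioP b.
have row x y : splice_fun i a b x = Some y -> y.1 = x.1.
  by rewrite /splice_fun; case: ifP => _ /io_row.
split.
- move=> x1 x2 y xy1 xy2; move: (xy1) (xy2).
  rewrite /splice_fun -(row _ _ xy1) -(row _ _ xy2).
  by case: ifP => _; [exact: bi | exact: ai].
- move=> x1 x2 y1 y2 xy1 xy2 x12; move: (xy1) (xy2).
  have [e12|ne12] := eqVneq x1.1 x2.1.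
    rewrite /splice_fun e12; case: ifP => _ h1 h2.
      exact: bm h1 h2 x12.
    exact: am h1 h2 x12.
  move=> _ _; apply/ltW/lexi_lt_row; rewrite (row _ _ xy1) (row _ _ xy2).
  by rewrite lt_neqAle ne12 lexi_le_row.
- apply: (@sub_finite_set _ _ (~` pdom a `|` ~` pdom b)).
    move=> x; rewrite -setCI => nx [[y ay] [z bz]]; apply: nx.
    by rewrite /pdom /splice_fun /=; case: ifP => _; [exists z | exists y].
  by rewrite finite_setU.
- apply: (@sub_finite_set _ _ (~` pran a `|` ~` pran b)).
    move=> y; rewrite -setCI => ny [[x ax] [z bz]]; apply: ny.
    have [yi|yi] := eqVneq y.1 i.
      by exists z; rewrite /splice_fun -(io_row bz) yi eqxx.
    by exists x; rewrite /splice_fun -(io_row ax) (negbTE yi).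
  by rewrite finite_setU.
Qed.

Lemma sigma_rows_subset I J : I `<=` J -> sigma_rows I `<=` sigma_rows J.
Proof. by move=> IJ ab [F [fF FI h]]; exists F; split=> // y /FI /IJ. Qed.

Lemma sigma_rowsU1 i I :
  sigma_rows (i |` I) = rel_comp (sigma_rows [set i]) (sigma_rows I).
Proof.
apply/seteqP; split=> -[a b].
  (* The splice differs from [a] only in row [i] and agrees there with [b], so [F] is divided
     between the two factors. *)
  move=> [F [fF FI ab]]; exists (mkio (is_io_splice i a b)).
    exists (F `&` [set y | y.1 = i]); split.
    - by apply: sub_finite_set fF => y [].
    - by move=> y [].
    - move=> x y Fy /=; rewrite /splice_fun; case: eqVneq => // xi.
      have h : y.1 = i -> a x = Some y <-> b x = Some y.
        by move=> yi; apply: ab => Fy'; apply: Fy.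
      by split=> xy; apply/h => //; rewrite (io_row xy).
  exists (F `&` [set y | I y.1]); split.
  - by apply: sub_finite_set fF => y [].
  - by move=> y [].
  - move=> x y Fy /=; rewrite /splice_fun; case: eqVneq => // xi.
    have h : y.1 = x.1 -> a x = Some y <-> b x = Some y.
      move=> yx; apply: ab => Fy'; apply: Fy; split=> //.
      (* Off row [i], an exceptional point must lie in a row of [I]. *)
      by have [yi|//] := FI _ Fy'; rewrite -yx yi eqxx in xi.
    by split=> xy; apply/h => //; exact: io_row xy.
move=> [c ac cb]; apply: (cong_trans (sigma_rows_congruence _)).
  by apply: sigma_rows_subset ac => j; left.
by apply: sigma_rows_subset cb => j; right.
Qed.

Lemma sigma_rows0 : sigma_rows set0 = diagonal.
Proof.
apply/seteqP; split=> -[a b] /=; last first.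
  by rewrite /diagonal /= => ->; apply: cong_refl; exact: sigma_rows_congruence.
move=> [F [_ F0 ab]]; apply: io_eq => x.
have {}ab y : a x = Some y <-> b x = Some y by apply: ab => /F0.
case E: (b x) => [y|]; first by apply/ab.
by case E': (a x) => [y|//]; rewrite -E; apply/esym/ab.
Qed.

Lemma sigma_comp_rows k (i : 'I_k -> 'I_n) :
  sigma_comp i = sigma_rows (range i).
Proof.
rewrite /sigma_comp; elim: k i => [|k IH] i.
  rewrite big_ord0 -sigma_rows0; congr sigma_rows.
  by apply/seteqP; split=> // j [[]].
(* Peeling off the first factor adds the row [i ord0] to those of the remaining factors. *)
rewrite big_ord_recl IH sigma_rows1 -sigma_rowsU1; congr sigma_rows.
apply/seteqP; split=> [_ [->|[j _ <-]]|_ [j _ <-]].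
- by exists ord0.
- by exists (lift ord0 j).
- by case: (unliftP ord0 j) => [j' ->|->]; [right; exists j' | left].
Qed.

(** Transitivity of [R] absorbs the chain of intermediate elements, and reflexivity the closing
    diagonal. *)
Lemma sigma_comp_subset k (i : 'I_k -> 'I_n) R :
  congruence R -> (forall j, sigma (i j) `<=` R) -> sigma_comp i `<=` R.
Proof.
rewrite /sigma_comp => cR; elim: k i => [|k IH] i iR.
  by rewrite big_ord0 => -[a b]; rewrite /diagonal /= => ->; exact: cong_refl.
rewrite big_ord_recl => -[a b] [c ac cb].
apply: (cong_trans cR) (iR ord0 _ ac) _.
by apply: IH cb => j; exact: iR.
Qed.

End RowCongruences.

Theorem proposition2p13 (n : nat) (n_gt0 : (0 < n)%N)
    (k : nat) (k_le_n : (k <= n)%N)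
    (i : 'I_k -> 'I_n) (i_inj : injective i) :
  sigma_comp i = cong_join (fun j : 'I_k => sigma (i j)) /\
  congruence (sigma_comp i).
Proof.
have cS : congruence (sigma_comp i).
  by rewrite sigma_comp_rows; exact: sigma_rows_congruence.
split=> //; apply/seteqP; split.
  move=> ab abS R [cR iR]; apply: sigma_comp_subset abS => // j cd jcd.
  by apply: iR; exists j.
(* The composition is itself a congruence containing every [sigma (i j)], hence one of those
   intersected in the join. *)
move=> ab; apply; split=> //; rewrite sigma_comp_rows => cd [j _].
by rewrite sigma_rows1; apply: sigma_rows_subset => _ ->; exists j.
Qed.
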